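(* Let $\mathfrak{g}=\mathfrak{sl}_2\otimes\mathfrak{J}\oplus V\otimes\mathfrak{M}\oplus\mathfrak{D}$ be a short $\mathfrak{sl}_2$-Lie superalgebra, with operations $\cdot,\bullet,\star,\langle-,-\rangle,\partial$ determined by its bracket. Then $$\{\alpha\in\mathfrak{g}:h\alpha=2\alpha\}=e\otimes\mathfrak{J}\cong\mathfrak{J},\qquad \{\alpha\in\mathfrak{g}:h\alpha=\alpha\}=e_1\otimes\mathfrak{M}\cong\mathfrak{M},$$ and, writing $\tilde a=e\otimes a$ for $a\in\mathfrak{J}$ and $\tilde m=e_1\otimes m$ for $m\in\mathfrak{M}$, the operations are given in terms of the Lie bracket and the $\mathfrak{sl}_2$-action by $$\widetilde{a\cdot b}=-\tfrac12[f\tilde a,\tilde b],\qquad \widetilde{a\bullet m}=-[f\tilde a,\tilde m]=[\tilde a,f\tilde m],\qquad \widetilde{m\star n}=[\tilde m,\tilde n],$$ $$\langle a,b\rangle=\tfrac14[f\tilde a,f\tilde b],\qquad \partial_{m,n}=\tfrac12\big([\tilde m,f\tilde n]-[f\tilde m,\tilde n]\big)$$ for all $a,b\in\mathfrak{J}$ and $m,n\in\mathfrak{M}$.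
   Context: Everything is over $\mathbb{C}$. $\mathfrak{sl}_2=\mathfrak{sl}_2(\mathbb{C})$ has standard basis $e,f,h$ with $[e,f]=h$, $[h,e]=2e$, $[h,f]=-2f$; $V=\mathbb{C}e_1\oplus\mathbb{C}e_2$ is its natural representation ($ee_2=e_1$, $fe_1=e_2$, $he_1=e_1$, $he_2=-e_2$); both have even degree. $\kappa(x,y)=4\,\mathrm{tr}(xy)$; $\det:V\otimes V\to\mathbb{C}$ is the determinant form; $\odot:V\otimes V\to\mathfrak{sl}_2$ is bilinear with $e_1\odot e_1=e$, $e_1\odot e_2=e_2\odot e_1=-\tfrac12h$, $e_2\odot e_2=-f$. A short $\mathfrak{sl}_2$-Lie superalgebra is a Lie superalgebra $\mathfrak{g}$ on which $\mathfrak{sl}_2$ acts by even derivations (the action of $f$ on $\alpha\in\mathfrak{g}$ is written $f\alpha$, etc.), with an $\mathfrak{sl}_2$-module decomposition $\mathfrak{g}=\mathfrak{sl}_2\otimes\mathfrak{J}\oplus V\otimes\mathfrak{M}\oplus\mathfrak{D}$, where $\mathfrak{J},\mathfrak{M},\mathfrak{D}$ are superspaces with trivial $\mathfrak{sl}_2$-action, so $\mathfrak{D}=\mathfrak{g}^{\mathfrak{sl}_2}$. By $\mathfrak{sl}_2$-invariance its bracket has the form $[d,x\otimes a]=x\otimes d(a)$, $[d,v\otimes m]=v\otimes d(m)$, $[x\otimes a,y\otimes b]=[x,y]\otimes a\cdot b+\tfrac12\kappa(x,y)\langle a,b\rangle$, $[x\otimes a,v\otimes m]=x(v)\otimes a\bullet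 m$, $[v\otimes m,w\otimes n]=(v\odot w)\otimes m\star n+\det(v,w)\partial_{m,n}$ (for $x,y\in\mathfrak{sl}_2$, $v,w\in V$, $a,b\in\mathfrak{J}$, $m,n\in\mathfrak{M}$, $d\in\mathfrak{D}$) for unique even bilinear maps $\cdot:\mathfrak{J}\otimes\mathfrak{J}\to\mathfrak{J}$, $\bullet:\mathfrak{J}\otimes\mathfrak{M}\to\mathfrak{M}$, $\star:\mathfrak{M}\otimes\mathfrak{M}\to\mathfrak{J}$, $\langle-,-\rangle:\mathfrak{J}\otimes\mathfrak{J}\to\mathfrak{D}$, $\partial:\mathfrak{M}\otimes\mathfrak{M}\to\mathfrak{D}$; these are the operations determined by the bracket. *)

(* Defs.v *)
From HB Require Import structures.
From mathcomp Require Import all_boot all_order all_algebra.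
From mathcomp Require Import complex.
From mathcomp Require Import boolp classical_sets reals.

Set Implicit Arguments.
Unset Strict Implicit.
Unset Printing Implicit Defensive.

Import GRing.Theory.

Local Open Scope ring_scope.
Local Open Scope classical_set_scope.
Local Open Scope complex_scope.

(* The field of complex numbers is [R[i]] with [R : realType]. *)

Section Sl2.
Variable R : realType.
Local Notation C := R[i].

Definition traceless : {pred 'M[C]_2} := fun A => \tr A == 0.

Fact traceless_submod_closed : submod_closed traceless.
Proof.
split=> [|a u v /eqP tu /eqP tv]; first by rewrite /in_mem /= /traceless raddf0.
by rewrite /in_mem /= /traceless mxtraceD mxtraceZ tu tv mulr0 addr0.
Qed.
HB.instance Definition _ :=
  GRing.isSubmodClosed.Build C 'M[C]_2 traceless traceless_submod_closed.

Record sl2 := Sl2 { sl2_mx :> 'M[C]_2; sl2_traceless : sl2_mx \in traceless }.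
HB.instance Definition _ := [isSub for sl2_mx].
HB.instance Definition _ := [Choice of sl2 by <:].
HB.instance Definition _ := [SubChoice_isSubLmodule of sl2 by <:].

Fact sl2_e_subproof : delta_mx 0 1 \in traceless.
Proof.
by rewrite /in_mem /= /traceless /mxtrace !big_ord_recl big_ord0 !mxE /= !addr0.
Qed.
Definition sl2_e : sl2 := Sl2 sl2_e_subproof.

Fact sl2_f_subproof : delta_mx 1 0 \in traceless.
Proof.
by rewrite /in_mem /= /traceless /mxtrace !big_ord_recl big_ord0 !mxE /= !addr0.
Qed.
Definition sl2_f : sl2 := Sl2 sl2_f_subproof.

Fact sl2_h_subproof : delta_mx 0 0 - delta_mx 1 1 \in traceless.
Proof.
rewrite /in_mem /= /traceless /mxtrace !big_ord_recl big_ord0 !mxE /=.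
by rewrite !addr0 subr0 sub0r subrr.
Qed.
Definition sl2_h : sl2 := Sl2 sl2_h_subproof.

Fact sl2_bracket_subproof (x y : sl2) : x *m y - y *m x \in traceless.
Proof. by rewrite /in_mem /= /traceless raddfB /= mxtrace_mulC subrr. Qed.
Definition sl2_bracket (x y : sl2) : sl2 := Sl2 (sl2_bracket_subproof x y).

Definition kappa (x y : sl2) : C := 4 * \tr (x *m y).

Local Notation natV := 'cV[C]_2.

Definition natV1 : natV := delta_mx 0 0.
Definition natV2 : natV := delta_mx 1 0.

Definition natV_act (x : sl2) (v : natV) : natV := x *m v.

Definition natV_det (v w : natV) : C := \det (row_mx v w : 'M_2).

(* The bilinear map with e1.e1 = e, e1.e2 = e2.e1 = -h/2 and e2.e2 = -f,
   written in the coordinates of v and w. *)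
Definition natV_odot (v w : natV) : sl2 :=
  (v 0 0 * w 0 0) *: sl2_e
  - (2^-1 * (v 0 0 * w 1 0 + v 1 0 * w 0 0)) *: sl2_h
  - (v 1 0 * w 1 0) *: sl2_f.

End Sl2.

Section Superspaces.
Variable R : realType.
Local Notation C := R[i].
Local Notation natV := 'cV[C]_2.

(* [grade false] is the even part and [grade true] the odd part; parities add
   by [addb], and the sign (-1)^{pq} is [(-1) ^+ (p && q)]. *)
Record superspace := Superspace {
  superspace_sort :> lmodType C;
  grade : bool -> set superspace_sort;
  grade0 : forall p, grade p 0;
  gradeP : forall p (k : C) u v,
    grade p u -> grade p v -> grade p (k *: u + v);
  grade_sum : forall u,
    exists u0 u1, [/\ grade false u0, grade true u1 & u = u0 + u1];
  grade_direct : forall u, grade false u -> grade true u -> u = 0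
}.

Definition even_bilinear (U V W : superspace) (b : U -> V -> W) : Prop :=
  forall p q u v, grade p u -> grade q v -> grade (p (+) q) (b u v).

(* [phi] is an isomorphism of superspaces from [U] onto the subset [S] of [W],
   [S] being graded by the induced parity. *)
Definition superspace_iso_onto (U W : superspace) (phi : U -> W) (S : set W) :
    Prop :=
  [/\ linear phi, injective phi, range phi = S
    & forall p u, grade p (phi u) <-> grade p u].

Record lieSuperalgebra := LieSuperalgebra {
  lie_superspace :> superspace;
  lie : {bilinear lie_superspace -> lie_superspace -> lie_superspace};
  lie_even : even_bilinear lie;
  lie_skew : forall p q x y, grade p x -> grade q y ->
    lie x y = - ((-1) ^+ (p && q) *: lie y x);
  lie_jacobi : forall p q x y z, grade p x -> grade q y ->
    lie x (lie y z) = lie (lie x y) z + (-1) ^+ (p && q) *: lie y (lie x z)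
}.

(* The universal property of the tensor product. *)
Definition is_tensor (U W T : lmodType C) (t : {bilinear U -> W -> T}) : Prop :=
  forall (Z : lmodType C) (b : {bilinear U -> W -> Z}),
    exists l : {linear T -> Z},
      (forall u w, l (t u w) = b u w) /\
      (forall l' : {linear T -> Z},
         (forall u w, l' (t u w) = b u w) -> l' =1 l).

(* The decomposition is the linear bijection [short_sum].  Since J, M and D are
   trivial sl2-modules, the fields [short_sum_act*] state its equivariance on
   generators; x (x) a and v (x) m have the parity of a and m. *)
Record shortSl2 := ShortSl2 {
  short_lie :> lieSuperalgebra;
  sl2_act : {bilinear sl2 R -> short_lie -> short_lie};
  sl2_act_bracket : forall x y u,
    sl2_act (sl2_bracket x y) u =
      sl2_act x (sl2_act y u) - sl2_act y (sl2_act x u);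
  sl2_act_even : forall x p u, grade p u -> grade p (sl2_act x u);
  sl2_act_derivation : forall x u v,
    sl2_act x (lie short_lie u v) =
      lie short_lie (sl2_act x u) v + lie short_lie u (sl2_act x v);
  short_J : superspace;
  short_M : superspace;
  short_D : superspace;
  sl2J : lmodType C;
  sl2J_tensor : {bilinear sl2 R -> short_J -> sl2J};
  sl2J_tensorP : is_tensor sl2J_tensor;
  natVM : lmodType C;
  natVM_tensor : {bilinear natV -> short_M -> natVM};
  natVM_tensorP : is_tensor natVM_tensor;
  short_sum : {linear (sl2J * natVM * short_D)%type -> short_lie};
  short_sum_bij : bijective short_sum;
  short_sum_actJ : forall x y a,
    sl2_act x (short_sum (sl2J_tensor y a, 0, 0)) =
      short_sum (sl2J_tensor (sl2_bracket x y) a, 0, 0);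
  short_sum_actM : forall x v m,
    sl2_act x (short_sum (0, natVM_tensor v m, 0)) =
      short_sum (0, natVM_tensor (natV_act x v) m, 0);
  short_sum_actD : forall x d, sl2_act x (short_sum (0, 0, d)) = 0;
  short_sum_evenJ : forall p y a, grade p a ->
    grade p (short_sum (sl2J_tensor y a, 0, 0));
  short_sum_evenM : forall p v m, grade p m ->
    grade p (short_sum (0, natVM_tensor v m, 0));
  short_sum_evenD : forall p d, grade p d -> grade p (short_sum (0, 0, d))
}.

Section Short.
Variable G : shortSl2.
Local Notation J := (short_J G).
Local Notation M := (short_M G).
Local Notation D := (short_D G).

Definition tensJ (x : sl2 R) (a : J) : G :=
  short_sum G (sl2J_tensor G x a, 0, 0).
Definition tensM (v : natV) (m : M) : G :=
  short_sum G (0, natVM_tensor G v m, 0).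
Definition inD (d : D) : G := short_sum G (0, 0, d).

Definition tildeJ (a : J) : G := tensJ (sl2_e R) a.
Definition tildeM (m : M) : G := tensM (natV1 R) m.

(* The operations on J, M and D through which the bracket of [G] is expressed;
   [opDJ d a] is d(a) and [opDM d m] is d(m). *)
Record bracketOps := BracketOps {
  opDJ : {bilinear D -> J -> J};
  opDM : {bilinear D -> M -> M};
  op_dot : {bilinear J -> J -> J};
  op_bullet : {bilinear J -> M -> M};
  op_star : {bilinear M -> M -> J};
  op_angle : {bilinear J -> J -> D};
  op_partial : {bilinear M -> M -> D};
  opDJ_even : even_bilinear opDJ;
  opDM_even : even_bilinear opDM;
  op_dot_even : even_bilinear op_dot;
  op_bullet_even : even_bilinear op_bullet;
  op_star_even : even_bilinear op_star;
  op_angle_even : even_bilinear op_angle;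
  op_partial_even : even_bilinear op_partial;
  lie_DJ : forall d x a, lie G (inD d) (tensJ x a) = tensJ x (opDJ d a);
  lie_DM : forall d v m, lie G (inD d) (tensM v m) = tensM v (opDM d m);
  lie_JJ : forall x y a b,
    lie G (tensJ x a) (tensJ y b) =
      tensJ (sl2_bracket x y) (op_dot a b)
      + inD ((2^-1 * kappa x y) *: op_angle a b);
  lie_JM : forall x v a m,
    lie G (tensJ x a) (tensM v m) = tensM (natV_act x v) (op_bullet a m);
  lie_MM : forall v w m n,
    lie G (tensM v m) (tensM w n) =
      tensJ (natV_odot v w) (op_star m n)
      + inD (natV_det v w *: op_partial m n)
}.

End Short.
End Superspaces.

(* Main.v *)
Require Import Defs.
From HB Require Import structures.
From mathcomp Require Import all_boot all_order all_algebra.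
From mathcomp Require Import complex.
From mathcomp Require Import boolp classical_sets reals.
From mathcomp Require Import ring.

(** The element h acts diagonally on the decomposition of g: e, h, f have
weights 2, 0, -2 in sl2, the vectors e_1, e_2 have weights 1, -1 in V, and D
has weight 0.  So e is, up to scaling, the only vector of weight 2 among the
sl2-coefficients and V has none, while e_1 is the only one of weight 1; the
eigenspaces of h for 2 and 1 can only be e (x) J and e_1 (x) M.  To say this
for tensor products known only by their universal property, the property is
used in two ways: its existence part turns the coordinate functionals of a
basis u_i of U into linear maps c_i from U (x) W to W, and its uniqueness
part shows that every z is the sum of the u_i (x) c_i z
([tensor_coordinates]).  Comparing coordinates in h alpha = mu alpha then
kills each component of weight different from mu ([coordinates_eigen],
[weight_space]).

The maps to e (x) J and e_1 (x) M are even, linear and injective, and such a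
map always reflects parity, since the component of u of the wrong parity is
sent to an element both even and odd ([even_embedding_grade]).

The formulas for the operations come from evaluating the bracket on
f (e (x) a) = - h (x) a and f (e_1 (x) m) = e_2 (x) m.  Each one isolates a
single operation because kappa(h, e) = 0 and det(e_1, e_1) = 0, because
[h, h] = 0, and, for the last formula, because the symmetric product of V
cancels in the difference while the skew form det doubles. *)

Set Implicit Arguments.
Unset Strict Implicit.
Unset Printing Implicit Defensive.

Import GRing.Theory Num.Theory.
Local Open Scope ring_scope.
Local Open Scope classical_set_scope.

(** * Coordinates in a tensor product *)

Section TensorCoordinates.
Variables (R : realType) (U W T : lmodType R[i]).
Variables (t : {bilinear U -> W -> T}) (n : nat) (u : 'I_n -> U).

(** The maps [c] behave as the functionals dual to [u], tensored with the
identity of [W]. *)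
Definition coordinates (c : 'I_n -> {linear T -> W}) : Prop :=
  (forall i j w, c i (t (u j) w) = (i == j)%:R *: w) /\
  (forall z, z = \sum_i t (u i) (c i z)).

(** The map [c i] is the factorization of [(x, w) |-> phi i x *: w] through the
tensor product.  The endomorphism [z |-> \sum_i t (u i) (c i z)] fixes every
pure tensor because [phi] is dual to [u], so it is the identity by uniqueness
of factorizations. *)
Lemma tensor_coordinates (phi : 'I_n -> U -> R[i]) :
    is_tensor t -> (forall i, scalar (phi i)) ->
    (forall i j, phi i (u j) = (i == j)%:R) ->
    (forall x, x = \sum_i phi i x *: u i) ->
  exists c, coordinates c.
Proof.
move=> tP phi_lin phi_u u_span.
have /choice [c cE] (i : 'I_n) : exists c : {linear T -> W},
    forall x w, c (t x w) = phi i x *: w.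
  pose b x (w : W) : W := (phi i x : R[i]) *: w.
  have bP : bilinear_for *:%R *:%R b.
    split=> [w k x y|x k v w]; rewrite /= /b.
      by rewrite phi_lin scalerDl scalerA.
    by rewrite scalerDr !scalerA [_ * k]mulrC.
  pose bM := bilinear_isBilinear.Build R[i] U W W *:%R *:%R b bP.
  pose B : {bilinear U -> W -> W} := HB.pack b bM.
  by have [c [cE _]] := tP W B; exists c.
exists c; split=> [i j w|z]; first by rewrite cE phi_u.
pose g z : T := \sum_i t (u i) (c i z).
have gP : linear g.
  move=> k x y; rewrite /g scaler_sumr -big_split; apply: eq_bigr => i _ /=.
  by rewrite linearP linearPr.
pose gM := GRing.isLinear.Build R[i] T T *:%R g gP.
pose g' : {linear T -> T} := HB.pack g gM.
have [l [_ l_uniq]] := tP T t.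
have g_t x w : g' (t x w) = t x w.
  rewrite /= /g [in RHS](u_span x) linear_sumlz; apply: eq_bigr => i _.
  by rewrite cE linearZr_LR linearZl_LR.
exact: (etrans (l_uniq idfun (fun _ _ => erefl) z) (esym (l_uniq g' g_t z))).
Qed.

(** Applying [c i] to the eigenvalue equation gives [lam i *: c i z] on one side
and [mu *: c i z] on the other. *)
Lemma coordinates_eigen c (lam : 'I_n -> R[i]) mu z : coordinates c ->
    \sum_i lam i *: t (u i) (c i z) = mu *: z ->
  forall i, lam i != mu -> c i z = 0.
Proof.
move=> [c_u _] eig i lam_mu.
have /eqP := congr1 (c i) eig; rewrite linear_sum linearZ (bigD1 i) //=.
rewrite big1 => [|j ji]; last first.
  by rewrite linearZ /= c_u eq_sym (negPf ji) scale0r scaler0.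
rewrite linearZ /= c_u eqxx scale1r addr0 -subr_eq0 -scalerBl.
by rewrite scaler_eq0 subr_eq0 (negPf lam_mu) => /eqP.
Qed.

End TensorCoordinates.

(** * Weights and structure constants of sl2 and V *)

Lemma forall_ord2 (P : 'I_2 -> Prop) : P 0 -> P 1 -> forall i, P i.
Proof.
move=> P0 P1 [[|[|//]] i]; [move: P0|move: P1]; congr P; exact: val_inj.
Qed.

Lemma forall_ord3 (P : 'I_3 -> Prop) : P 0 -> P 1 -> P 2 -> forall i, P i.
Proof.
move=> P0 P1 P2 [[|[|[|//]]] i];
  [move: P0|move: P1|move: P2]; congr P; exact: val_inj.
Qed.

Lemma sum_ord2 (A : nmodType) (F : 'I_2 -> A) : \sum_i F i = F 0 + F 1.
Proof. by rewrite big_ord_recl big_ord1; congr (_ + F _); apply: val_inj. Qed.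

Lemma sum_ord3 (A : nmodType) (F : 'I_3 -> A) : \sum_i F i = F 0 + F 1 + F 2.
Proof.
rewrite !big_ord_recl big_ord0 addr0 addrA.
by congr (_ + F _ + F _); apply: val_inj.
Qed.

(** These hold by computation, but only as long as the operations of [sl2] are
folded; hence an explicit rule, used before any simplification. *)
Lemma sl2_mxE (R : realType) :
  (forall x y : sl2 R, sl2_mx (x + y) = sl2_mx x + sl2_mx y) *
  (forall x : sl2 R, sl2_mx (- x) = - sl2_mx x) *
  (forall k (x : sl2 R), sl2_mx (k *: x) = k *: sl2_mx x) *
  (sl2_mx (0 : sl2 R) = 0).
Proof. by []. Qed.

Lemma sl2P (R : realType) (x y : sl2 R) :
  (forall i j, sl2_mx x i j = sl2_mx y i j) -> x = y.
Proof. by move=> xy; apply: val_inj; apply/matrixP. Qed.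

Ltac sl2_entries :=
  apply: sl2P; do 2 (elim/forall_ord2);
  rewrite ?sl2_mxE ?mxE ?sum_ord2 /= ?mxE /=; try ring.

Lemma det_mx22 (K : comNzRingType) (A : 'M[K]_2) :
  \det A = A 0 0 * A 1 1 - A 0 1 * A 1 0.
Proof.
have lift00 : lift (0 : 'I_2) (0 : 'I_1) = 1 by apply: val_inj.
have lift10 : lift (1 : 'I_2) (0 : 'I_1) = 0 by apply: val_inj.
rewrite (expand_det_row _ 0) sum_ord2 /cofactor !det_mx11 !mxE lift00 lift10 /=.
ring.
Qed.

Section Sl2.
Variable R : realType.
Notation C := R[i].
Notation e := (sl2_e R).
Notation f := (sl2_f R).
Notation h := (sl2_h R).
Notation natV1 := (natV1 R).
Notation natV2 := (natV2 R).

(** Listed by decreasing weight, so that index 0 is the highest weight. *)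
Definition sl2_basis (i : 'I_3) : sl2 R := [:: e; h; f]`_i.
(** Weights are integers so that distinct weights are told apart by
computation. *)
Definition sl2_weight (i : 'I_3) : int := [:: 2; 0; -2]`_i.
(** The matrix entries at (0, 1), (0, 0) and (1, 0), dual to e, h and f. *)
Definition sl2_coord (i : 'I_3) (x : sl2 R) : C :=
  sl2_mx x [:: 0; 0; 1]`_i [:: 1; 0; 0]`_i.

Definition natV_basis (i : 'I_2) : 'cV[C]_2 := delta_mx i 0.
Definition natV_weight (i : 'I_2) : int := [:: 1; -1]`_i.

Lemma sl2_coord_scalar i : scalar (sl2_coord i).
Proof. by move=> k x y; rewrite /sl2_coord !sl2_mxE !mxE. Qed.

Lemma sl2_coord_basis i j : sl2_coord i (sl2_basis j) = (i == j)%:R.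
Proof.
elim/forall_ord3: i; elim/forall_ord3: j;
  by rewrite /sl2_coord /sl2_basis /= !mxE /= ?subr0.
Qed.

Lemma sl2_basis_span x : x = \sum_i sl2_coord i x *: sl2_basis i.
Proof.
have /eqP := sl2_traceless x.
rewrite /mxtrace sum_ord2 => x_tr.
(* The entry at (1, 1) is the only one that the coordinates do not record. *)
have {x_tr} x11 : sl2_mx x 1 1 = - sl2_mx x 0 0.
  by apply/eqP; rewrite -addr_eq0 addrC x_tr.
rewrite sum_ord3 /sl2_coord /sl2_basis /=; sl2_entries.
by rewrite x11; ring.
Qed.

Lemma natV_coord_scalar (i : 'I_2) : scalar (fun v : 'cV[C]_2 => v i 0).
Proof. by move=> k v w; rewrite !mxE. Qed.

Lemma natV_coord_basis i j : natV_basis j i 0 = (i == j)%:R.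
Proof. by rewrite mxE andbT. Qed.

Lemma natV_basis_span (v : 'cV[C]_2) : v = \sum_i v i 0 *: natV_basis i.
Proof.
apply/colP; elim/forall_ord2; rewrite sum_ord2 !mxE /=; ring.
Qed.

Lemma bracket_h_basis i :
  sl2_bracket h (sl2_basis i) = (sl2_weight i)%:~R *: sl2_basis i.
Proof.
elim/forall_ord3: i; rewrite /sl2_basis /sl2_weight /=; sl2_entries.
Qed.

Lemma natV_act_h_basis i :
  natV_act h (natV_basis i) = (natV_weight i)%:~R *: natV_basis i.
Proof.
apply/colP; elim/forall_ord2: i; elim/forall_ord2;
  rewrite /natV_weight !mxE !sum_ord2 !mxE /=; ring.
Qed.

Lemma bracket_fe : sl2_bracket f e = - h.
Proof. sl2_entries. Qed.

Lemma natV_act_f1 : natV_act f natV1 = natV2.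
Proof. by rewrite /natV_act /= mul_delta_mx. Qed.

Lemma natV_act_e2 : natV_act e natV2 = natV1.
Proof. by rewrite /natV_act /= mul_delta_mx. Qed.

Lemma natV_act_h1 : natV_act h natV1 = natV1.
Proof. by rewrite (natV_act_h_basis 0) scale1r. Qed.

Lemma kappa_he : kappa h e = 0.
Proof.
rewrite /kappa /mxtrace !sum_ord2 !mxE !sum_ord2.
by rewrite !mxE /=; ring.
Qed.

Lemma kappa_hh : kappa h h = 8.
Proof.
rewrite /kappa /mxtrace !sum_ord2 !mxE !sum_ord2.
by rewrite !mxE /=; ring.
Qed.

Lemma odot11 : natV_odot natV1 natV1 = e.
Proof. by rewrite /natV_odot !mxE /=; sl2_entries. Qed.

Lemma odot12 : natV_odot natV1 natV2 = natV_odot natV2 natV1.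
Proof. by rewrite /natV_odot !mxE /= !(mul0r, mulr0, mulr1, addr0, add0r). Qed.

Lemma natV_detE (v w : 'cV[C]_2) : natV_det v w = v 0 0 * w 1 0 - v 1 0 * w 0 0.
Proof.
have row0 i : (row_mx v w : 'M_2) i 0 = v i 0.
  by rewrite -(row_mxEl v w); congr (row_mx v w i _); apply: val_inj.
have row1 i : (row_mx v w : 'M_2) i 1 = w i 0.
  by rewrite -(row_mxEr v w); congr (row_mx v w i _); apply: val_inj.
by rewrite /natV_det det_mx22 !row0 !row1; ring.
Qed.

Lemma natV_det12 : natV_det natV1 natV2 = 1.
Proof. by rewrite natV_detE !mxE /=; ring. Qed.

Lemma natV_det21 : natV_det natV2 natV1 = -1.
Proof. by rewrite natV_detE !mxE /=; ring. Qed.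

Lemma natV_det11 : natV_det natV1 natV1 = 0.
Proof. by rewrite natV_detE !mxE /=; ring. Qed.

End Sl2.

(** * Parity under even embeddings *)

(** If [phi u] has parity [p], so has the image of the component of [u] of the
other parity, which is the difference of [phi u] and the image of the component
of parity [p].  That image then has both parities, so it vanishes, and
so does the component, by injectivity. *)
Lemma even_embedding_grade (R : realType) (U W : superspace R)
    (phi : {linear U -> W}) : injective phi ->
    (forall p u, grade p u -> grade p (phi u)) ->
  forall p u, grade p (phi u) <-> grade p u.
Proof.
move=> phi_inj phi_even p u; split=> [gu|]; last exact: phi_even.
have [u0 [u1 [gu0 gu1 uE]]] := grade_sum u.
have gradeB q x y : grade q x -> grade q y -> grade q (x - y :> W).
  by move=> gx gy; rewrite addrC -scaleN1r; apply: gradeP.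
case: p gu => gu.
  suff u00 : u0 = 0 by rewrite uE u00 add0r.
  apply: phi_inj; rewrite linear0; apply: grade_direct; first exact: phi_even.
  have -> : phi u0 = phi u - phi u1 by rewrite uE linearD addrK.
  by apply: gradeB => //; apply: phi_even.
suff u10 : u1 = 0 by rewrite uE u10 addr0.
apply: phi_inj; rewrite linear0; apply: grade_direct; last exact: phi_even.
have -> : phi u1 = phi u - phi u0 by rewrite uE linearD addrC addKr.
by apply: gradeB => //; apply: phi_even.
Qed.

(** * The weight spaces of a short sl2-Lie superalgebra *)

Section WeightSpaces.
Variables (R : realType) (G : shortSl2 R).
Notation h := (sl2_h R).
Notation f := (sl2_f R).

Lemma sl2J_coordinates : exists c, coordinates (sl2J_tensor G) (@sl2_basis R) c.
Proof.
exact: (tensor_coordinates (@sl2J_tensorP R G) (@sl2_coord_scalar R)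
  (@sl2_coord_basis R) (@sl2_basis_span R)).
Qed.

Lemma natVM_coordinates :
  exists c, coordinates (natVM_tensor G) (@natV_basis R) c.
Proof.
exact: (tensor_coordinates (@natVM_tensorP R G)
  (@natV_coord_scalar R) (@natV_coord_basis R) (@natV_basis_span R)).
Qed.

Lemma short_sum_inj : injective (short_sum G).
Proof. exact: bij_inj (short_sum_bij G). Qed.

Definition inJ (t : sl2J G) : G := short_sum G (t, 0, 0).
Definition inM (w : natVM G) : G := short_sum G (0, w, 0).

Fact inJ_linear : linear inJ.
Proof.
move=> k s t; rewrite /inJ -linearP; congr (short_sum G _).
by do 2 ?[apply: injective_projections => /=]; rewrite ?scaler0 ?addr0.
Qed.
HB.instance Definition _ := GRing.isLinear.Build _ _ _ _ inJ inJ_linear.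

Fact inM_linear : linear inM.
Proof.
move=> k s t; rewrite /inM -linearP; congr (short_sum G _).
by do 2 ?[apply: injective_projections => /=]; rewrite ?scaler0 ?addr0.
Qed.
HB.instance Definition _ := GRing.isLinear.Build _ _ _ _ inM inM_linear.

Lemma short_sumE t w d : short_sum G (t, w, d) = inJ t + inM w + inD d.
Proof.
rewrite /inJ /inM /inD -!linearD; congr (short_sum G _).
by do 2 ?[apply: injective_projections => /=]; rewrite ?add0r ?addr0.
Qed.

Lemma tensJ_linear x : linear (@tensJ R G x).
Proof. by move=> k a b; rewrite /tensJ linearPr; apply: inJ_linear. Qed.

Lemma tensM_linear v : linear (@tensM R G v).
Proof. by move=> k a b; rewrite /tensM linearPr; apply: inM_linear. Qed.

(** A nonzero weight is required because D lies in the weight space for 0. *)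
Lemma weight_space (mu : int) (alpha : G) : mu != 0 ->
    sl2_act G h alpha = mu%:~R *: alpha ->
  exists a m, alpha =
    \sum_(i | sl2_weight i == mu) tensJ (sl2_basis R i) (a i) +
    \sum_(i | natV_weight i == mu) tensM (natV_basis R i) (m i).
Proof.
move=> mu_neq0; have [g _ gK] := short_sum_bij G; rewrite -(gK alpha).
case: (g alpha) => [[t w] d] {alpha gK}.
have [cJ cJP] := sl2J_coordinates; have [cM cMP] := natVM_coordinates.
have actJ : sl2_act G h (inJ t) =
    inJ (\sum_i (sl2_weight i)%:~R *: sl2J_tensor G (sl2_basis R i) (cJ i t)).
  rewrite [in LHS](cJP.2 t) !linear_sum; apply: eq_bigr => i _.
  by rewrite [LHS]short_sum_actJ bracket_h_basis linearZl_LR.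
have actM : sl2_act G h (inM w) =
    inM (\sum_i (natV_weight i)%:~R *:
           natVM_tensor G (natV_basis R i) (cM i w)).
  rewrite [in LHS](cMP.2 w) !linear_sum; apply: eq_bigr => i _.
  by rewrite [LHS]short_sum_actM natV_act_h_basis linearZl_LR.
rewrite {1}short_sumE !linearD /= actJ actM [sl2_act G h (inD d)]short_sum_actD.
have inD0 : inD (0 : short_D G) = 0 :> G by exact: (linear0 (short_sum G)).
rewrite -[in LHS]inD0 -short_sumE -linearZ => /short_sum_inj[].
move=> /(coordinates_eigen cJP) tE /(coordinates_eigen cMP) wE /esym/eqP.
rewrite scaler_eq0 intr_eq0 (negPf mu_neq0) /= => /eqP ->.
exists (cJ ^~ t), (cM ^~ w).
rewrite short_sumE inD0 addr0 {1}(cJP.2 t) {1}(cMP.2 w) !linear_sum /=.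
rewrite [in LHS](bigID (fun i => sl2_weight i == mu)) /=.
rewrite [X in _ + X](bigID (fun i => natV_weight i == mu)) /=.
rewrite [X in _ + X + _]big1 ?[X in _ + (_ + X)]big1 ?addr0 // => i i_mu.
  by rewrite wE ?eqr_int // linear0r linear0.
by rewrite tE ?eqr_int // linear0r linear0.
Qed.

Lemma tensJ_basis_inj i : injective (tensJ (sl2_basis R i) : _ -> G).
Proof.
have [c [c_basis _]] := sl2J_coordinates.
move=> a b /short_sum_inj[/(congr1 (c i))].
by rewrite !c_basis eqxx !scale1r.
Qed.

Lemma tensM_basis_inj i : injective (tensM (natV_basis R i) : _ -> G).
Proof.
have [c [c_basis _]] := natVM_coordinates.
move=> m n /short_sum_inj[/(congr1 (c i))].
by rewrite !c_basis eqxx !scale1r.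
Qed.

Lemma act_tensJ x y a : sl2_act G x (tensJ y a) = tensJ (sl2_bracket x y) a.
Proof. exact: short_sum_actJ. Qed.

Lemma act_tensM x v m : sl2_act G x (tensM v m) = tensM (natV_act x v) m.
Proof. exact: short_sum_actM. Qed.

Lemma tensJZ k x a : tensJ (k *: x) a = k *: tensJ x a :> G.
Proof. by rewrite /tensJ linearZl_LR; exact: (linearZ_LR inJ). Qed.

Lemma tensJN x a : tensJ (- x) a = - tensJ x a :> G.
Proof. by rewrite /tensJ linearNl; exact: (linearN inJ). Qed.

Lemma tensJ0 a : tensJ 0 a = 0 :> G.
Proof. by rewrite /tensJ linear0l; exact: (linear0 inJ). Qed.

Lemma inDZ k d : inD (k *: d) = k *: inD d :> G.
Proof.
rewrite /inD -linearZ; congr (short_sum G _).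
by do 2 ?[apply: injective_projections => /=]; rewrite ?scaler0.
Qed.

Lemma weight2_space :
  [set alpha : G | sl2_act G h alpha = 2 *: alpha] = range (@tildeJ R G).
Proof.
apply/seteqP; split=> [alpha /= hE|_ /= [a _ <-]]; last first.
  by rewrite act_tensJ (bracket_h_basis _ 0) tensJZ.
have [//|a [m ->]] := @weight_space 2 alpha _ hE.
rewrite (big_pred1 0) => [|i]; last by elim/forall_ord3: i.
rewrite big_pred0 => [|i]; last by elim/forall_ord2: i.
by rewrite addr0; exists (a 0).
Qed.

Lemma weight1_space :
  [set alpha : G | sl2_act G h alpha = alpha] = range (@tildeM R G).
Proof.
apply/seteqP; split=> [alpha /= hE|_ /= [m _ <-]]; last first.
  by rewrite act_tensM natV_act_h1.
have [//||a [m ->]] := @weight_space 1 alpha; first by rewrite scale1r.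
rewrite big_pred0 => [|i]; last by elim/forall_ord3: i.
rewrite (big_pred1 0) => [|i]; last by elim/forall_ord2: i.
by rewrite add0r; exists (m 0).
Qed.

HB.instance Definition _ x :=
  GRing.isLinear.Build _ _ _ _ (@tensJ R G x) (tensJ_linear x).
HB.instance Definition _ v :=
  GRing.isLinear.Build _ _ _ _ (@tensM R G v) (tensM_linear v).

Lemma tildeJ_iso :
  superspace_iso_onto (@tildeJ R G)
    [set alpha : G | sl2_act G h alpha = 2 *: alpha].
Proof.
have tilde_inj := @tensJ_basis_inj 0.
split=> [||//|p a]; [exact: tensJ_linear|by []|by rewrite weight2_space|].
apply: even_embedding_grade => // q b; exact: short_sum_evenJ.
Qed.

Lemma tildeM_iso :
  superspace_iso_onto (@tildeM R G)
    [set alpha : G | sl2_act G h alpha = alpha].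
Proof.
have tilde_inj := @tensM_basis_inj 0.
split=> [||//|p a]; [exact: tensM_linear|by []|by rewrite weight1_space|].
apply: even_embedding_grade => // q b; exact: short_sum_evenM.
Qed.

(** * The action of f on the highest weight vectors *)

Lemma act_f_tildeJ a : sl2_act G f (tildeJ a) = - tensJ h a.
Proof. by rewrite act_tensJ bracket_fe tensJN. Qed.

Lemma act_f_tildeM m : sl2_act G f (tildeM m) = tensM (natV2 R) m.
Proof. by rewrite act_tensM natV_act_f1. Qed.

End WeightSpaces.

(** * The operations in terms of the bracket *)

Theorem proposition2p2 (R : realType) (G : shortSl2 R) (ops : bracketOps G) :
  let e := sl2_e R in
  let f := sl2_f R in
  let h := sl2_h R in
  [set alpha : G | sl2_act G h alpha = 2 *: alpha]
    = range (fun a : short_J G => tensJ e a) /\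
  superspace_iso_onto (@tildeJ R G)
    [set alpha : G | sl2_act G h alpha = 2 *: alpha] /\
  [set alpha : G | sl2_act G h alpha = alpha]
    = range (fun m : short_M G => tensM (natV1 R) m) /\
  superspace_iso_onto (@tildeM R G)
    [set alpha : G | sl2_act G h alpha = alpha] /\
  (forall a b : short_J G,
    tildeJ (op_dot ops a b)
      = - (2^-1 *: lie G (sl2_act G f (tildeJ a)) (tildeJ b))) /\
  (forall (a : short_J G) (m : short_M G),
    tildeM (op_bullet ops a m) = - lie G (sl2_act G f (tildeJ a)) (tildeM m) /\
    tildeM (op_bullet ops a m) = lie G (tildeJ a) (sl2_act G f (tildeM m))) /\
  (forall m n : short_M G,
    tildeJ (op_star ops m n) = lie G (tildeM m) (tildeM n)) /\
  (forall a b : short_J G,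
    inD (op_angle ops a b)
      = 4^-1 *: lie G (sl2_act G f (tildeJ a)) (sl2_act G f (tildeJ b))) /\
  (forall m n : short_M G,
    inD (op_partial ops m n)
      = 2^-1 *: (lie G (tildeM m) (sl2_act G f (tildeM n))
                 - lie G (sl2_act G f (tildeM m)) (tildeM n))).
Proof.
split; first exact: weight2_space.
split; first exact: tildeJ_iso.
split; first exact: weight1_space.
split; first exact: tildeM_iso.
split.
  (* [h, e] = 2e, whence the factor 1/2. *)
  move=> a b; rewrite act_f_tildeJ linearNl (lie_JJ ops) (bracket_h_basis _ 0).
  rewrite kappa_he mulr0 inDZ scale0r addr0 tensJZ scalerN opprK.
  by rewrite scalerK ?pnatr_eq0.
split.
  move=> a m; rewrite act_f_tildeJ act_f_tildeM linearNl !(lie_JM ops) opprK.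
  by rewrite natV_act_h1 natV_act_e2.
split.
  by move=> m n; rewrite (lie_MM ops) odot11 natV_det11 inDZ scale0r addr0.
split.
  move=> a b; rewrite !act_f_tildeJ linearNl linearNr opprK (lie_JJ ops).
  have -> : sl2_bracket (sl2_h R) (sl2_h R) = 0 by apply: val_inj; exact: subrr.
  (* kappa(h, h) / 2 = 4, whence the factor 1/4. *)
  rewrite tensJ0 add0r kappa_hh inDZ !scalerA.
  by rewrite (_ : _ * _ = 1) ?scale1r //; field.
move=> m n; rewrite !act_f_tildeM !(lie_MM ops) odot12 opprD addrACA.
rewrite subrr add0r natV_det12 natV_det21 !inDZ -scalerBl scalerA opprK.
by rewrite mulVf ?scale1r // pnatr_eq0.
Qed.
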